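(* Let $U=K\exp\{\tfrac i2\sum_{k=1}^3c_k\,\sigma_k\otimes\sigma_k\}K'\in\mathrm{SU}(4)$ with $K,K'\in\mathrm{SU}(2)\otimes\mathrm{SU}(2)$ and $c_1,c_2,c_3\in[0,\pi]$ (the non-local coordinates), and for a $2\times2$ density matrix $\rho_{\mathrm B}$ (the initial ancilla state) let $\mathcal D_{\rho_{\mathrm B}}[X]=\mathrm{tr}_{\mathrm B}\{U(X\otimes\rho_{\mathrm B})U^\dagger\}$ be the induced dynamical map on the qubit. Then: (a) any $U$ with only a single non-vanishing $c_k$ yields a unital map $\mathcal D_{\rho_{\mathrm B}}$ for the qubit; (b) two non-vanishing non-local coordinates are necessary but not yet sufficient for non-unitality of $\mathcal D_{\rho_{\mathrm B}}$, since non-unitality then still depends on $\rho_{\mathrm B}'=k_{\mathrm B}'\rho_{\mathrm B}k_{\mathrm B}'^\dagger$, i.e. on the initial ancilla state $\rho_{\mathrm B}$ and on the local operation $k_{\mathrm B}'$; (c) three non-vanishing non-local coordinates guarantee non-unitality of $\mathcal D_{\rho_{\mathrm B}}$, independent of the ancilla, provided $\rho_{\mathrm B}\neq\tfrac12\mathbb 1_{\mathrm B}$.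
   Context: $\sigma_1,\sigma_2,\sigma_3$ are the Pauli matrices; the first tensor factor of $\mathbb C^2\otimes\mathbb C^2$ is the qubit S and the second the ancilla B; $\mathrm{tr}_{\mathrm B}$ is the partial trace over the second factor. $k_{\mathrm B}'$ denotes the ancilla factor of $K'=k_{\mathrm S}'\otimes k_{\mathrm B}'$. A linear map $\mathcal D$ on $2\times2$ matrices is called unital if it maps the identity onto itself, and non-unital otherwise.
   Formalization: In (c), and in (b) where a non-unital choice of the ancilla state or of k_B' is asserted to exist, all c_k are assumed to be less than π, since at c_k = π that factor of U is local and the claims fail, e.g. c = (π, π/2, π/2) with ρ_B' = |0><0|, or c = (π, π/2, 0). *)

(* Defs.v *)
From HB Require Import structures.
From mathcomp Require Import all_boot all_order all_algebra.
From mathcomp Require Import all_classical all_reals all_analysis.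
From mathcomp Require Import complex.
From mathcomp Require mxtens.

Set Implicit Arguments.
Unset Strict Implicit.
Unset Printing Implicit Defensive.

Import Order.TTheory GRing.Theory Num.Theory.
Import numFieldNormedType.Exports.

Local Open Scope classical_set_scope.
Local Open Scope ring_scope.
Local Open Scope complex_scope.
Local Open Scope sesquilinear_scope.

(* Importing mxtens would put its tensor power [A ^t k] in conflict with the
   conjugate transpose [A ^t*]. *)
Notation "A *t B" := (mxtens.tensmx A B)
  (at level 40, left associativity, format "A  *t  B") : ring_scope.

(* The limit is taken in the matrix topology, that is, entrywise. *)
Definition expmx (K : numFieldType) (n : nat) (A : 'M[K]_n) : 'M[K]_n :=
  limn (series (fun k : nat => (k`!%:R)^-1 *: A ^+ k)).

Section Qubits.
Variable R : realType.
Local Notation C := R[i].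

Definition mx2 (a b c d : C) : 'M[C]_2 :=
  \matrix_(i < 2, j < 2)
    if i == 0 then (if j == 0 then a else b) else (if j == 0 then c else d).

(* sigma_1, sigma_2, sigma_3 are indexed by 0, 1, 2 : 'I_3. *)
Definition pauli (k : 'I_3) : 'M[C]_2 :=
  match val k with
  | 0 => mx2 0 1 1 0
  | 1 => mx2 0 (- 'i%C) 'i%C 0
  | _ => mx2 1 0 0 (- 1)
  end.

Definition special_unitary (n : nat) (A : 'M[C]_n) : Prop :=
  A \is unitarymx /\ \det A = 1.

(* On R[i], [0 <= z] means that z is real and nonnegative. *)
Definition density_matrix (n : nat) (rho : 'M[C]_n) : Prop :=
  [/\ rho \is hermsymmx,
      forall v : 'cV[C]_n, 0 <= (v ^t* *m rho *m v) 0 0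
    & \tr rho = 1].

Definition ptraceB (m n : nat) (M : 'M[C]_(m * n)) : 'M[C]_m :=
  \matrix_(i < m, j < m) \sum_(k < n)
     M (mxtens.mxtens_index (i, k)) (mxtens.mxtens_index (j, k)).

Definition nonlocal (c : 'I_3 -> R) : 'M[C]_(2 * 2) :=
  expmx (('i%C / 2%:R) *: \sum_(k < 3) (c k)%:C *: (pauli k *t pauli k)).

(* U = K exp{...} K' with K = kS (x) kB and K' = kS' (x) kB'. *)
Definition gate (c : 'I_3 -> R) (kS kB kS' kB' : 'M[C]_2) : 'M[C]_(2 * 2) :=
  (kS *t kB) *m nonlocal c *m (kS' *t kB').

Definition dynmap (U : 'M[C]_(2 * 2)) (rhoB : 'M[C]_2) (X : 'M[C]_2) : 'M[C]_2 :=
  ptraceB (U *m (X *t rhoB) *m U ^t*).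

Definition unital (D : 'M[C]_2 -> 'M[C]_2) : Prop := D 1%:M = 1%:M.

End Qubits.

(* Main.v *)
(* The factors exp(i c_k/2 sigma_k (x) sigma_k) commute, so the non-local part N is
   determined on the joint eigenspaces of the sigma_k (x) sigma_k and is a combination
   x_0 1 + sum_k x_k sigma_k (x) sigma_k.  Tracing out B gives, for rho' = kB' rho kB'^dagger,
     D[1] = kS (1 + sum_k (prod_(j <> k) sin c_j) tr(sigma_k rho') sigma_k) kS^dagger.
   Hence D is unital iff for every k some sin c_j with j <> k vanishes or the k-th Bloch
   coordinate tr(sigma_k rho') vanishes, and the claims follow: with exactly one vanishing
   c_k only the k-th Bloch coordinate of rho' matters, and a local rotation can make it zero
   or, unless rho = 1/2, nonzero. *)
Require Import Defs.
From HB Require Import structures.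
From mathcomp Require Import all_boot all_order all_algebra.
From mathcomp Require Import all_classical all_reals all_analysis.
From mathcomp Require Import complex.
From mathcomp Require Import ring.
From mathcomp Require mxtens.

Import Order.TTheory GRing.Theory Num.Theory.
Import numFieldNormedType.Exports.
Local Open Scope ring_scope.
Local Open Scope complex_scope.
Local Open Scope sesquilinear_scope.

Set Implicit Arguments.
Unset Strict Implicit.
Unset Printing Implicit Defensive.

(** * Exponential of a matrix with a known spectral decomposition *)

Section Exponential.
Local Open Scope classical_set_scope.
Variable (K : numFieldType).

(** Orthogonality of the [E i] makes powers act on the coefficients alone, and completeness covers
    the power 0. The partial sums of the exponential series are thus finite combinations of scalar
    series, and the limit is taken summand by summand. *)
Lemma expmx_idempotents (n : nat) (I : finType) (E : I -> 'M[K]_n) (l e : I -> K) :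
    (forall i j, E i *m E j = if i == j then E i else 0) ->
    \sum_i E i = 1%:M ->
    (forall i, series (fun k => (k`!%:R)^-1 * l i ^+ k) @ \oo --> e i) ->
  expmx (\sum_i l i *: E i) = \sum_i e i *: E i.
Proof.
move=> EE E1 le.
have XE k : (\sum_i l i *: E i) ^+ k = \sum_i l i ^+ k *: E i.
  elim: k => [|k IH]; first by rewrite expr0 [LHS](esym E1);
    apply: eq_bigr => i _; rewrite expr0 scale1r.
  rewrite exprSr IH [LHS]mulmx_suml; apply: eq_bigr => i _.
  rewrite mulmx_sumr (bigD1 i) //= big1 ?addr0 => [|j ji]; last first.
    by rewrite -scalemxAl -scalemxAr EE eq_sym (negPf ji) !scaler0.
  by rewrite -scalemxAl -scalemxAr EE eqxx scalerA -exprSr.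
rewrite /expmx.
have -> : series (fun k => (k`!%:R)^-1 *: (\sum_i l i *: E i) ^+ k) =
    \sum_i (fun m => series (fun k => (k`!%:R)^-1 * l i ^+ k) m *: E i).
  apply/funext => m; rewrite fct_sumE /series /=.
  under eq_bigr do rewrite XE scaler_sumr.
  rewrite exchange_big; apply: eq_bigr => i _.
  by rewrite scaler_suml; apply: eq_bigr => k _; rewrite scalerA.
apply/cvg_lim; first exact: norm_hausdorff.
elim/big_ind2 : _ => [|f x g y fx gy|i _].
- exact: cvg_cst.
- exact: cvgD.
- by apply: cvgZr_tmp; exact: le.
Qed.

End Exponential.

(** * The complex exponential on the imaginary axis *)

Section Cis.
Local Open Scope classical_set_scope.
Variable R : realType.
Local Notation C := R[i].
Local Notation Ctop := (Num.NumField.sort R[i]).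

Definition cis (t : R) : C := cos t +i* sin t.

Lemma cisD (s t : R) : cis (s + t) = cis s * cis t.
Proof. by rewrite /cis cosD sinD; simpc; congr (_ +i* _); rewrite addrC. Qed.

Lemma cvg_complex (u v : nat -> R) (a b : R) :
  u @ \oo --> a -> v @ \oo --> b -> (fun n => u n +i* v n : Ctop) @ \oo --> (a +i* b : Ctop).
Proof.
move=> ua vb; have cC (w : nat -> R) (x : R) :
    w @ \oo --> x -> (fun n => (w n)%:C : Ctop) @ \oo --> (x%:C : Ctop).
  (* The radius [e] is a complex number; its positivity says that it is real with positive real
     part, and that real part is the radius used for [w]. *)
  move=> wx; apply/cvgrPdist_lt => e; rewrite ltcE /= => /andP[/eqP e0 e1].
  have := wx; move/cvgrPdist_lt => /(_ _ e1); apply: filterS => n wn.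
  by rewrite -rmorphB normc_def /= expr0n addr0 sqrtr_sqr ltcE /= e0 eqxx.
have -> : (fun n => u n +i* v n) = (fun n => (u n)%:C + 'i%C * (v n)%:C).
  by apply/funext => n; rewrite [LHS]complexE.
rewrite [a +i* b]complexE; apply: cvgD; first exact: cC.
by apply: cvgM; [exact: cvg_cst|exact: cC].
Qed.

Lemma cvg_exp_cis (t : R) :
  series (fun k => (k`!%:R)^-1 * ('i%C * t%:C) ^+ k : Ctop) @ \oo --> (cis t : Ctop).
Proof.
have -> : series (fun k => (k`!%:R)^-1 * ('i%C * t%:C) ^+ k) =
    (fun n => series (cos_coeff t) n +i* series (sin_coeff t) n).
  apply/funext => n; rewrite [RHS]complexE /series /= !rmorph_sum mulr_sumr -big_split.
  apply: eq_bigr => k _; rewrite /cos_coeff /sin_coeff /=.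
  rewrite !rmorphM !rmorphV ?unitfE ?pnatr_eq0 -?lt0n ?fact_gt0 //.
  rewrite !rmorphXn !rmorphN !rmorph1 !rmorph_nat /=.
  rewrite exprMn.
  (* The powers of ['i] are split by parity, with the same parity factors and signs as in
     [cos_coeff] and [sin_coeff]. *)
  have -> : 'i%C ^+ k = (~~ odd k)%:R * (-1) ^+ k./2
       + 'i%C * ((odd k)%:R * (-1) ^+ k.-1./2) :> C.
    rewrite -[k in LHS]odd_double_half -mul2n exprD exprM sqr_i.
    case: (boolP (odd k)) => ok /=; last by rewrite expr0; ring.
    by rewrite -[in k.-1](odd_double_half k) ok /= doubleK expr1; ring.
  by ring.
apply: cvg_complex; rewrite ?(cos.unlock,sin.unlock); 
 [exact: is_cvg_series_cos_coeff|exact: is_cvg_series_sin_coeff].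
Qed.
End Cis.

(** * Sums and case analysis over small index types *)

Lemma sum_ord3 (V : nmodType) (F : 'I_3 -> V) :
  \sum_k F k = F 0 + F 1 + F 2%:R.
Proof.
rewrite !big_ord_recl big_ord0 addr0 addrA.
by congr (_ + F _ + F _); apply: val_inj.
Qed.

Lemma sum_option (V : nmodType) (I : finType) (F : option I -> V) :
  \sum_k F k = F None + \sum_k F (Some k).
Proof.
rewrite (bigD1 None) //=; congr (_ + _).
by rewrite (reindex_omap Some id) => [|[]] //=; apply: eq_bigl => k; rewrite eqxx.
Qed.

Lemma ord3P (P : 'I_3 -> Prop) : P 0 -> P 1 -> P 2%:R -> forall k, P k.
Proof.
move=> P0 P1 P2 [[|[|[|k]]] lk] //.
- by rewrite (_ : Ordinal lk = 0) //; apply: val_inj.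
- by rewrite (_ : Ordinal lk = 1) //; apply: val_inj.
- by rewrite (_ : Ordinal lk = 2%:R) //; apply: val_inj.
Qed.

Lemma ord2P (P : 'I_2 -> Prop) : P 0 -> P 1 -> forall k, P k.
Proof.
move=> P0 P1 [[|[|k]] lk] //.
- by rewrite (_ : Ordinal lk = 0) //; apply: val_inj.
- by rewrite (_ : Ordinal lk = 1) //; apply: val_inj.
Qed.

(** * Calculus of 2x2 matrices and the partial trace *)

Section QubitMatrices.
Variable R : realType.
Local Notation C := R[i].
Implicit Types a b c d : C.

Lemma mx2_eta (A : 'M[C]_2) : A = mx2 (A 0 0) (A 0 1) (A 1 0) (A 1 1).
Proof.
by apply/matrixP; apply: ord2P; apply: ord2P; rewrite mxE.
Qed.

Lemma mx2P (A : 'M[C]_2) : exists a b c d, A = mx2 a b c d.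
Proof. by do 4![eexists]; exact: mx2_eta. Qed.

Lemma mx2D a b c d a' b' c' d' :
  mx2 a b c d + mx2 a' b' c' d' = mx2 (a + a') (b + b') (c + c') (d + d').
Proof. by apply/matrixP => i j; rewrite !mxE; do !case: ifP. Qed.

Lemma mx2Z (x : C) a b c d : x *: mx2 a b c d = mx2 (x * a) (x * b) (x * c) (x * d).
Proof. by apply/matrixP => i j; rewrite !mxE; do !case: ifP. Qed.

Lemma mx2M a b c d a' b' c' d' : mx2 a b c d *m mx2 a' b' c' d' =
  mx2 (a * a' + b * c') (a * b' + b * d') (c * a' + d * c') (c * b' + d * d').
Proof.
by apply/matrixP => i j; rewrite !mxE !big_ord_recl big_ord0 addr0 !mxE /=; do !case: ifP.
Qed.

Lemma scalar_mx2 (x : C) : x%:M = mx2 x 0 0 x.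
Proof.
by apply/matrixP; apply: ord2P; apply: ord2P; rewrite !mxE.
Qed.

Lemma adj_mx2 a b c d : (mx2 a b c d) ^t* = mx2 a^*%R c^*%R b^*%R d^*%R.
Proof. by apply/matrixP => i j; rewrite !mxE; do !case: ifP. Qed.

Lemma mxtrace_mx2 a b c d : \tr (mx2 a b c d) = a + d.
Proof. by rewrite /mxtrace !big_ord_recl big_ord0 addr0 !mxE. Qed.

Lemma det_mx2 a b c d : \det (mx2 a b c d) = a * d - b * c.
Proof.
rewrite (expand_det_row _ 0) !big_ord_recl big_ord0 addr0 /cofactor !det_mx11 !mxE /=.
by rewrite !expr0 !expr1 mul1r mulN1r mulrN.
Qed.

Lemma mx2_inj a b c d a' b' c' d' :
  mx2 a b c d = mx2 a' b' c' d' -> [/\ a = a', b = b', c = c' & d = d'].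
Proof.
by move=> /matrixP e; split; [have := e 0 0|have := e 0 1|have := e 1 0|have := e 1 1];
  rewrite !mxE.
Qed.

Lemma pauliE : ((pauli R 0 = mx2 0 1 1 0) * (pauli R 1 = mx2 0 (- 'i%C) 'i%C 0)
  * (pauli R 2%:R = mx2 1 0 0 (- 1)))%type.
Proof. by []. Qed.

Lemma conj_i : ('i%C : C)^*%R = - 'i%C.
Proof. by rewrite /= ; simpc. Qed.

Lemma conj_realC (x : R) : (x%:C : C)^*%R = x%:C.
Proof. exact: conjc_real. Qed.

Lemma adj_tens (m n p q : nat) (A : 'M[C]_(m, n)) (B : 'M[C]_(p, q)) :
  (A *t B) ^t* = A ^t* *t B ^t*.
Proof. by rewrite mxtens.trmx_tens mxtens.map_mxT. Qed.

Lemma tens1mx1 (m n : nat) : (1%:M : 'M[C]_m) *t (1%:M : 'M[C]_n) = 1%:M.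
Proof.
apply/matrixP => i j.
case: (mxtens.mxtens_indexP i) => a b; case: (mxtens.mxtens_indexP j) => a' b'.
by rewrite mxtens.tensmxE !mxE -natrM mulnb (can_eq (@mxtens.mxtens_indexK _ _)).
Qed.

Lemma ptraceBD (m n : nat) (A B : 'M[C]_(m * n)) :
  ptraceB (A + B) = ptraceB A + ptraceB B.
Proof.
by apply/matrixP => i j; rewrite !mxE -big_split; apply: eq_bigr => k _; rewrite mxE.
Qed.

Lemma ptraceBZ (m n : nat) (x : C) (A : 'M[C]_(m * n)) :
  ptraceB (x *: A) = x *: ptraceB A.
Proof.
by apply/matrixP => i j; rewrite !mxE mulr_sumr; apply: eq_bigr => k _; rewrite mxE.
Qed.

Lemma ptraceB_tens (m n : nat) (A : 'M[C]_m) (B : 'M[C]_n) :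
  ptraceB (A *t B) = \tr B *: A.
Proof.
apply/matrixP => i j; rewrite !mxE mulrC mulr_sumr.
by apply: eq_bigr => k _; rewrite mxtens.tensmxE.
Qed.

Lemma ptraceB_sum (I : Type) (r : seq I) (m n : nat) (F : I -> 'M[C]_(m * n)) :
  ptraceB (\sum_(k <- r) F k) = \sum_(k <- r) ptraceB (F k).
Proof.
apply: (big_morph _ (@ptraceBD m n)).
by apply/matrixP => i j; rewrite !mxE big1 // => k _; rewrite mxE.
Qed.

(** [None] stands for the identity, so that a sum over the full operator basis splits into one term
    and a sum over ['I_3]. *)
Definition pauli4 (k : option 'I_3) : 'M[C]_2 := if k is Some j then pauli R j else 1%:M.

(** On the identity input [kS'] cancels against its adjoint, and [kB] cancels inside the partial
    trace by cyclicity. By bilinearity the rest is a double sum of product operators, on which the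
    partial trace is an ordinary trace of the second factor. *)
Lemma dynmap_pauli_sum (x : option 'I_3 -> C) (kS kB kS' kB' rho : 'M[C]_2) :
    kS' \is unitarymx -> kB \is unitarymx ->
  dynmap ((kS *t kB) *m (\sum_k x k *: (pauli4 k *t pauli4 k)) *m (kS' *t kB')) rho 1%:M
  = kS *m (\sum_k \sum_l (x k * (x l)^*%R
       * \tr (pauli4 k *m (kB' *m rho *m kB' ^t*) *m (pauli4 l) ^t*))
       *: (pauli4 k *m (pauli4 l) ^t*)) *m kS ^t*.
Proof.
move=> /unitarymxP uS' uB; rewrite /dynmap.
set rho' := kB' *m rho *m _.
have -> (K N K' X : 'M[C]_(2 * 2)) : (K *m N *m K') *m X *m (K *m N *m K') ^t* =
    K *m (N *m (K' *m X *m K' ^t*) *m N ^t*) *m K ^t*.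
  by rewrite !trmx_mul !map_mxM !mulmxA.
rewrite [(kS' *t kB') ^t*]adj_tens !mxtens.tensmx_mul mulmx1 uS' -/rho'.
have -> : (\sum_k x k *: (pauli4 k *t pauli4 k)) ^t* =
    \sum_k (x k)^*%R *: ((pauli4 k) ^t* *t (pauli4 k) ^t*) :> 'M[C]_(2 * 2).
  rewrite raddf_sum /= (raddf_sum (map_mx _)); apply: eq_bigr => k _.
  by rewrite linearZ /= map_mxZ [X in _ *: X]adj_tens.
rewrite [in RHS]mulmx_sumr [in RHS]mulmx_suml.
rewrite 2![in LHS]mulmx_suml [in LHS]mulmx_sumr [in LHS]mulmx_suml ptraceB_sum.
apply: eq_bigr => k _.
rewrite [in RHS]mulmx_sumr [in RHS]mulmx_suml.
rewrite 2![in LHS]mulmx_sumr [in LHS]mulmx_suml ptraceB_sum.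
apply: eq_bigr => l _.
rewrite -!(scalemxAl, scalemxAr).
rewrite !mxtens.tensmx_mul mulmx1 adj_tens !mxtens.tensmx_mul !ptraceBZ ptraceB_tens.
have uB' : kB ^t* *m kB = 1%:M := mulmx1C (unitarymxP uB).
by rewrite mxtrace_mulC (mulmxA (kB ^t*)) uB' mul1mx !scalerA.
Qed.

End QubitMatrices.

(** * Evaluation of the double sum over the Pauli basis *)

Section PauliSandwich.
Variable R : realType.
Local Notation C := R[i].

Lemma adj_pauli (k : 'I_3) : (pauli R k) ^t* = pauli R k.
Proof.
have conjN (z : C) : (- z)^*%R = - z^*%R by exact: rmorphN.
move: k; apply: ord3P; rewrite !pauliE adj_mx2 ?conjN ?conj_i ?conjC0 ?conjC1 ?opprK //.
Qed.

Lemma adj_pauli4 (k : option 'I_3) : (@pauli4 R k) ^t* = @pauli4 R k.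
Proof. by case: k => [k|] /=; [exact: adj_pauli|rewrite trmx1 map_mx1]. Qed.

(** Diagonal pairs contribute multiples of the identity, pairs with one identity factor contribute
    to that Pauli matrix. For two distinct Pauli matrices the factor ['i] of their product meets the
    factor [- 'i] of the product in the trace, so both orders contribute to the third matrix with a
    plus sign. *)
Lemma pauli_sandwich_sum (x0 x1 x2 x3 : C) (rho : 'M[C]_2) :
  let x := fun k : option 'I_3 => if k is Some j then
    (match val j with 0 => x1 | 1 => x2 | _ => x3 end) else x0 in
  \sum_k \sum_l (x k * (x l)^*%R * \tr (@pauli4 R k *m rho *m (@pauli4 R l) ^t*))
       *: (@pauli4 R k *m (@pauli4 R l) ^t*)
  = ((x0 * x0^*%R + x1 * x1^*%R + x2 * x2^*%R + x3 * x3^*%R) * \tr rho)%:M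
  + ((x0 * x1^*%R + x1 * x0^*%R + x2 * x3^*%R + x3 * x2^*%R)
       * \tr (pauli R 0 *m rho)) *: pauli R 0
  + ((x0 * x2^*%R + x2 * x0^*%R + x1 * x3^*%R + x3 * x1^*%R)
       * \tr (pauli R 1 *m rho)) *: pauli R 1
  + ((x0 * x3^*%R + x3 * x0^*%R + x1 * x2^*%R + x2 * x1^*%R)
       * \tr (pauli R 2%:R *m rho)) *: pauli R 2%:R.
Proof.
move=> x; under eq_bigr do under eq_bigr do rewrite adj_pauli4.
rewrite sum_option sum_ord3 !sum_option !sum_ord3.
have [a [b [c [d ->]]]] := mx2P rho.
rewrite /pauli4 /x /= !pauliE.
(* The identity is polynomial in the coefficients and their conjugates taken as independent
   variables; besides that it needs only the square of ['i]. *)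
move: (x0^*%R) (x1^*%R) (x2^*%R) (x3^*%R) => y0 y1 y2 y3.
rewrite !scalar_mx2 !(mx2M, mx2Z, mx2D, mxtrace_mx2).
rewrite !(mul0r, mulr0, mul1r, mulr1, add0r, addr0).
have ii : ('i%C : C) * 'i%C = -1 by rewrite -expr2 sqr_i.
move: ('i%C : C) ii => j jj.
by congr mx2; ring: jj.
Qed.

End PauliSandwich.

(** * Joint spectral projections of two commuting involutions *)

Section Involutions.
Variables (K : numFieldType) (n : nat).

(** For an involution [G] this is the spectral projection for the eigenvalue [(-1) ^+ b], so [false]
    belongs to the eigenvalue 1. *)
Definition involution_proj (G : 'M[K]_n) (b : bool) : 'M[K]_n :=
  2%:R^-1 *: (1%:M + (-1) ^+ b *: G).

Lemma involution_projM (G : 'M[K]_n) (b b' : bool) : G *m G = 1%:M ->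
  involution_proj G b *m involution_proj G b' =
  if b == b' then involution_proj G b else 0.
Proof.
move=> GG; rewrite /involution_proj -scalemxAl -scalemxAr scalerA.
rewrite mulmxDl !mulmxDr !mul1mx mulmx1 -scalemxAl -scalemxAr GG.
(* The identity is abstracted to keep [mxE] from expanding its entries. *)
move: (1%:M : 'M[K]_n) => I1.
by case: b; case: b'; rewrite ?expr0 ?expr1; apply/matrixP => i j; rewrite !mxE /=; field.
Qed.

Lemma involution_proj_sum (G : 'M[K]_n) : \sum_b involution_proj G b = 1%:M.
Proof.
rewrite big_bool /involution_proj /=; move: (1%:M : 'M[K]_n) => I1.
by apply/matrixP => i j; rewrite !mxE; field.
Qed.

Lemma involution_proj_comm (G H : 'M[K]_n) (a b : bool) : G *m H = H *m G ->
  involution_proj G a *m involution_proj H b =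
  involution_proj H b *m involution_proj G a.
Proof.
move=> GH; rewrite /involution_proj -!(scalemxAl, scalemxAr).
rewrite !(mulmxDl, mulmxDr) -!(scalemxAl, scalemxAr) !mul1mx !mulmx1 GH.
move: (1%:M : 'M[K]_n) => I1.
by apply/matrixP => i j; rewrite !mxE; ring.
Qed.

Lemma involution_proj2M (G H : 'M[K]_n) (a b a' b' : bool) :
    G *m G = 1%:M -> H *m H = 1%:M -> G *m H = H *m G ->
  involution_proj G a *m involution_proj H b
    *m (involution_proj G a' *m involution_proj H b') =
  if (a == a') && (b == b') then involution_proj G a *m involution_proj H b else 0.
Proof.
move=> GG HH GH; have PQ := involution_proj_comm a' b GH.
have PP := involution_projM a a' GG; have QQ := involution_projM b b' HH.
rewrite mulmxA -(mulmxA _ (involution_proj H b)) -PQ mulmxA -mulmxA PP QQ.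
by case: (a == a'); case: (b == b'); rewrite ?mul0mx ?mulmx0.
Qed.

Lemma involution_proj2E (G1 G2 G3 : 'M[K]_n) (a b : bool) : G1 *m G2 = - G3 ->
  involution_proj G1 a *m involution_proj G2 b =
  4%:R^-1 *: (1%:M + (-1) ^+ a *: G1 + (-1) ^+ b *: G2 - ((-1) ^+ a * (-1) ^+ b) *: G3).
Proof.
move=> G12; rewrite /involution_proj /= -!(scalemxAl, scalemxAr).
rewrite !(mulmxDl, mulmxDr) -!(scalemxAl, scalemxAr) !mul1mx !mulmx1 G12.
move: (1%:M : 'M[K]_n) => I1.
by apply/matrixP => i j; rewrite !mxE; field.
Qed.

(** A discrete Fourier transform over two signs, from spectral coefficients to coefficients of 1,
    [G1], [G2], [G3]; the last one has its sign reversed because [G1 *m G2 = - G3]. *)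
Lemma involution_proj2_comb (G1 G2 G3 : 'M[K]_n) (z : bool -> bool -> K) :
    G1 *m G2 = - G3 ->
  let E a b := z a b *: (involution_proj G1 a *m involution_proj G2 b) in
  E true true + E true false + (E false true + E false false) =
    ((z true true + z true false + z false true + z false false) / 4%:R) *: 1%:M
  + ((z false true + z false false - z true true - z true false) / 4%:R) *: G1
  + ((z true false + z false false - z true true - z false true) / 4%:R) *: G2
  + ((z true false + z false true - z true true - z false false) / 4%:R) *: G3.
Proof.
move=> G12 E; rewrite /E !(involution_proj2E _ _ G12) /= !expr0 !expr1.
move: (1%:M : 'M[K]_n) => I1.
by apply/matrixP => i j; rewrite !mxE; field.
Qed.

Lemma eq_comb4 (A B D E : 'M[K]_n) (x y z w x' y' z' w' : K) :
  x = x' -> y = y' -> z = z' -> w = w' ->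
  x *: A + y *: B + z *: D + w *: E = x' *: A + y' *: B + z' *: D + w' *: E.
Proof. by move=> -> -> -> ->. Qed.
End Involutions.

(** * Closed form of the non-local gate *)

Section NonlocalGate.
Variable R : realType.
Local Notation C := R[i].

Lemma pauliM : (forall k, pauli R k *m pauli R k = 1%:M) /\
  [/\ pauli R 0 *m pauli R 1 = 'i%C *: pauli R 2%:R &
      pauli R 1 *m pauli R 0 = - 'i%C *: pauli R 2%:R].
Proof.
have ii : ('i%C : C) * 'i%C = -1 by rewrite -expr2 sqr_i.
split; first by apply: ord3P; rewrite pauliE mx2M scalar_mx2; move: ('i%C : C) ii => j jj;
  congr mx2; ring: jj.
by split; rewrite !pauliE mx2M mx2Z; move: ('i%C : C) ii => j jj; congr mx2; ring.
Qed.

Definition pauli2 (k : 'I_3) : 'M[C]_(2 * 2) := pauli R k *t pauli R k.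

Lemma pauli2_sq k : pauli2 k *m pauli2 k = 1%:M.
Proof. by rewrite mxtens.tensmx_mul (pauliM.1 k) tens1mx1. Qed.

Lemma tensmxZZ (m n p q : nat) (x y : C) (A : 'M[C]_(m, n)) (B : 'M[C]_(p, q)) :
  (x *: A) *t (y *: B) = (x * y) *: (A *t B).
Proof. by apply/matrixP => i j; rewrite !mxE; ring. Qed.

(** The factor ['i] or [- 'i] arises in both tensor factors and squares to -1 in either order, so
    the tensor squares commute although the Pauli matrices anticommute. *)
Lemma pauli2_01 : pauli2 0 *m pauli2 1 = - pauli2 2%:R.
Proof.
rewrite mxtens.tensmx_mul pauliM.2.1 // tensmxZZ -expr2 sqr_i scaleN1r //.
Qed.

Lemma pauli2_10 : pauli2 1 *m pauli2 0 = - pauli2 2%:R.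
Proof.
rewrite mxtens.tensmx_mul; case: pauliM => _ [_ ->].
by rewrite tensmxZZ mulrNN -expr2 sqr_i scaleN1r.
Qed.

(* The exponential is read off on the four joint eigenspaces of the commuting
   involutions G1 and G2. *)
Lemma expmx_involutions (n : nat) (G1 G2 G3 : 'M[C]_n) (c1 c2 c3 : R) :
    G1 *m G1 = 1%:M -> G2 *m G2 = 1%:M -> G1 *m G2 = - G3 -> G2 *m G1 = - G3 ->
  let C1 := (cos (c1 / 2%:R))%:C in let S1 := (sin (c1 / 2%:R))%:C in
  let C2 := (cos (c2 / 2%:R))%:C in let S2 := (sin (c2 / 2%:R))%:C in
  let C3 := (cos (c3 / 2%:R))%:C in let S3 := (sin (c3 / 2%:R))%:C in
  expmx (('i%C / 2%:R) *: (c1%:C *: G1 + c2%:C *: G2 + c3%:C *: G3)) =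
    (C1 * C2 * C3 + 'i%C * (S1 * S2 * S3)) *: 1%:M
  + (C1 * S2 * S3 + 'i%C * (S1 * C2 * C3)) *: G1
  + (S1 * C2 * S3 + 'i%C * (C1 * S2 * C3)) *: G2
  + (S1 * S2 * C3 + 'i%C * (C1 * C2 * S3)) *: G3.
Proof.
move=> sq1 sq2 G12 G21 C1 S1 C2 S2 C3 S3.
pose E (ab : bool * bool) := involution_proj G1 ab.1 *m involution_proj G2 ab.2.
(* The exponent has eigenvalue ['i * t] on a joint eigenspace; the minus sign in the last term comes
   from [G3 = - G1 *m G2]. *)
pose t (ab : bool * bool) : R := (-1) ^+ ab.1 * (c1 / 2%:R) + (-1) ^+ ab.2 * (c2 / 2%:R)
  - (-1) ^+ ab.1 * (-1) ^+ ab.2 * (c3 / 2%:R).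
have EE s s' : E s *m E s' = if s == s' then E s else 0.
  by rewrite /E involution_proj2M // ?G12 ?G21 //; case: s s' => a b [a' b'].
have sumE (F : bool * bool -> 'M[C]_n) :
    \sum_s F s = F (true, true) + F (true, false) + (F (false, true) + F (false, false)).
  rewrite (eq_bigr (fun s => F (s.1, s.2))) => [|[] //].
  by rewrite -(pair_bigA _ (fun a b => F (a, b))) /= !big_bool.
have E1 : \sum_s E s = 1%:M.
  have aux (P P' Q Q' : 'M[C]_n) : P + P' = 1%:M -> Q + Q' = 1%:M ->
      P *m Q + P *m Q' + (P' *m Q + P' *m Q') = 1%:M.
    by move=> p q; rewrite -!mulmxDr -mulmxDl p q mulmx1.
  by rewrite sumE; apply: aux;
    [rewrite -(involution_proj_sum G1)|rewrite -(involution_proj_sum G2)]; rewrite big_bool.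
have -> : ('i%C / 2%:R) *: (c1%:C *: G1 + c2%:C *: G2 + c3%:C *: G3) =
    \sum_s ('i%C * (t s)%:C) *: E s.
  have tE a b : 'i%C * (t (a, b))%:C = 'i%C / 2%:R * ((-1) ^+ a * c1%:C + (-1) ^+ b * c2%:C
      - (-1) ^+ a * (-1) ^+ b * c3%:C).
    have half (x : R) : x%:C = 2%:R * (x / 2%:R)%:C :> C.
      by rewrite rmorphM fmorphV rmorph_nat mulrCA divff ?mulr1 ?pnatr_eq0.
    rewrite (half c1) (half c2) (half c3) /t /=.
    move: (c1 / _) (c2 / _) (c3 / _) => r1 r2 r3.
    rewrite rmorphB !rmorphD !rmorphM !rmorph_sign /=.
    move: ('i%C : C) (r1%:C) (r2%:C) (r3%:C) => im {}r1 {}r2 {}r3.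
    by field.
  rewrite sumE (involution_proj2_comb (fun a b => 'i%C * (t (a, b))%:C) G12) !tE.
  (* The exponent is given a zero coefficient at the identity, to match the four-term form. *)
  rewrite /= !expr0 !expr1 !scalerDr !scalerA -[LHS]add0r -[0](scale0r 1%:M) !addrA.
  move: ('i%C : C) (c1%:C) (c2%:C) (c3%:C) => im r1 r2 r3.
  apply: eq_comb4.
- by field.
- by field.
- by field.
- by field.
rewrite (expmx_idempotents (e := fun s => cis (t s)) EE E1); last first.
  by move=> s; exact: cvg_exp_cis.
have cisE (x : R) : cis x = (cos x)%:C + 'i%C * (sin x)%:C by rewrite [LHS]complexE.
have cisN (x : R) : cis (- x) = (cos x)%:C - 'i%C * (sin x)%:C.
  by rewrite cisE cosN sinN rmorphN mulrN.
rewrite sumE (involution_proj2_comb (fun a b => cis (t (a, b))) G12).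
rewrite /t /= !expr0 !expr1 !mulN1r !mul1r ?mulrN ?opprK ?mulr1 ?mulNr ?mul1r ?opprK.
(* Each phase factors over the three half angles, and the four signed averages reduce to products of
   their sines and cosines. *)
rewrite !cisD !cisN !cisE -/C1 -/C2 -/C3 -/S1 -/S2 -/S3.
have ii : ('i%C : C) * 'i%C = -1 by rewrite -expr2 sqr_i.
move: ('i%C : C) C1 C2 C3 S1 S2 S3 ii {EE E1} => im C1 C2 C3 S1 S2 S3 ii.
apply: eq_comb4.
- by field: ii.
- by field: ii.
- by field: ii.
- by field: ii.
Qed.

Lemma nonlocalE (c : 'I_3 -> R) :
  let C1 := (cos (c 0 / 2%:R))%:C in let S1 := (sin (c 0 / 2%:R))%:C in
  let C2 := (cos (c 1 / 2%:R))%:C in let S2 := (sin (c 1 / 2%:R))%:C in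
  let C3 := (cos (c 2%:R / 2%:R))%:C in let S3 := (sin (c 2%:R / 2%:R))%:C in
  nonlocal c =
    (C1 * C2 * C3 + 'i%C * (S1 * S2 * S3)) *: 1%:M
  + (C1 * S2 * S3 + 'i%C * (S1 * C2 * C3)) *: pauli2 0
  + (S1 * C2 * S3 + 'i%C * (C1 * S2 * C3)) *: pauli2 1
  + (S1 * S2 * C3 + 'i%C * (C1 * C2 * S3)) *: pauli2 2%:R.
Proof.
rewrite /nonlocal sum_ord3; apply: expmx_involutions.
- exact: pauli2_sq.
- exact: pauli2_sq.
- exact: pauli2_01.
- exact: pauli2_10.
Qed.
End NonlocalGate.

(** * The image of the identity under the dynamical map *)

Section GateOnIdentity.
Variable R : realType.
Local Notation C := R[i].

Lemma prod_ord3_neq (F : 'I_3 -> R) :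
  [/\ \prod_(j | j != 0) F j = F 1 * F 2%:R,
      \prod_(j | j != 1) F j = F 0 * F 2%:R &
      \prod_(j | j != 2%:R) F j = F 0 * F 1].
Proof.
have prod3 (G : 'I_3 -> R) : \prod_k G k = G 0 * G 1 * G 2%:R.
  rewrite !big_ord_recl big_ord0 mulr1 mulrA.
  by congr (_ * G _ * G _); apply: val_inj.
by split; rewrite big_mkcond prod3 /= ?mulr1 ?mul1r.
Qed.

Lemma sin_half (x : R) : sin x = 2%:R * (sin (x / 2%:R) * cos (x / 2%:R)).
Proof.
rewrite [in LHS](_ : x = x / 2%:R + x / 2%:R); last by field.
by rewrite sinD; ring.
Qed.

Lemma mxtrace_conj (U rho : 'M[C]_2) : U \is unitarymx ->
  \tr (U *m rho *m U ^t*) = \tr rho.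
Proof. by move=> /unitarymxP/mulmx1C uU; rewrite mxtrace_mulC mulmxA uU mul1mx. Qed.

(** For the coefficients of the gate, the first quadratic form in [pauli_sandwich_sum] is 1, and
    each of the others is a product of two sines by the double-angle formula. *)
Lemma dynmap_gate1 (c : 'I_3 -> R) (kS kB kS' kB' rho : 'M[C]_2) :
    kB \is unitarymx -> kS' \is unitarymx -> kB' \is unitarymx ->
  dynmap (gate c kS kB kS' kB') rho 1%:M =
  kS *m ((\tr rho)%:M
    + \sum_k ((\prod_(j | j != k) sin (c j))%:C
              * \tr (pauli R k *m (kB' *m rho *m kB' ^t*))) *: pauli R k) *m kS ^t*.
Proof.
move=> uB uS' uB'.
pose C1 := cos (c 0 / 2%:R); pose S1 := sin (c 0 / 2%:R).
pose C2 := cos (c 1 / 2%:R); pose S2 := sin (c 1 / 2%:R).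
pose C3 := cos (c 2%:R / 2%:R); pose S3 := sin (c 2%:R / 2%:R).
pose z (a b : R) : C := a%:C + 'i%C * b%:C.
pose x0 := z (C1 * C2 * C3) (S1 * S2 * S3).
pose x1 := z (C1 * S2 * S3) (S1 * C2 * C3).
pose x2 := z (S1 * C2 * S3) (C1 * S2 * C3).
pose x3 := z (S1 * S2 * C3) (C1 * C2 * S3).
pose x (k : option 'I_3) : C := if k is Some j then
    (match val j with 0 => x1 | 1 => x2 | _ => x3 end) else x0.
have -> : gate c kS kB kS' kB' = (kS *t kB)
    *m (\sum_k x k *: (@pauli4 R k *t @pauli4 R k)) *m (kS' *t kB').
  rewrite /gate nonlocalE sum_option sum_ord3 /= tens1mx1 !addrA.
  by rewrite /x0 /x1 /x2 /x3 /z !rmorphM.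
(* Twice the real part of a product [z * z'^*]; this makes the quadratic forms below real. *)
have zJ a b a' b' : z a b * (z a' b')^*%R + z a' b' * (z a b)^*%R
    = (2%:R * (a * a' + b * b'))%:C.
  have zE u v : (z u v)^*%R = u%:C - 'i%C * v%:C.
    have cD (p q : C) : (p + q)^*%R = p^*%R + q^*%R by exact: rmorphD.
    have cM (p q : C) : (p * q)^*%R = p^*%R * q^*%R by exact: rmorphM.
    by rewrite /z cD cM conj_i !conj_realC mulNr.
  have rE : (2%:R * (a * a' + b * b'))%:C = 2%:R * (a%:C * a'%:C + b%:C * b'%:C) :> C.
    by rewrite [LHS]rmorphM rmorph_nat rmorphD !rmorphM.
  rewrite rE !zE /z.
  have ii : ('i%C : C) * 'i%C = -1 by rewrite -expr2 sqr_i.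
  by move: ('i%C : C) ii (a%:C) (b%:C) (a'%:C) (b'%:C) => im ii u v u' v'; ring: ii.
have zz a b : z a b * (z a b)^*%R = (a * a + b * b)%:C.
  by apply: (@mulfI C 2%:R); rewrite ?pnatr_eq0 // [LHS]mulr_natl mulr2n zJ rmorphM rmorph_nat.
have cs (t : R) : sin t * sin t = 1 - cos t * cos t.
  by have := cos2Dsin2 t; rewrite !expr2 => <-; ring.
have s0 : x0 * x0^*%R + x1 * x1^*%R + x2 * x2^*%R + x3 * x3^*%R = 1.
  rewrite !zz -!rmorphD -(rmorph1 (real_complex R)); congr (_%:C).
  have := cs (c 0 / 2%:R); have := cs (c 1 / 2%:R); have := cs (c 2%:R / 2%:R).
  rewrite -/C1 -/C2 -/C3 -/S1 -/S2 -/S3.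
  move: C1 C2 C3 S1 S2 S3 {x x0 x1 x2 x3} => C1 C2 C3 S1 S2 S3 e3 e2 e1.
  by ring: e1 e2 e3.
have s1 : x0 * x1^*%R + x1 * x0^*%R + x2 * x3^*%R + x3 * x2^*%R
    = (sin (c 1) * sin (c 2%:R))%:C.
  (* Both pairs of terms equal [2 * C2 * S2 * C3 * S3], the angle [c 0] dropping out through [cs].
     The forms [s2] and [s3] follow with the indices permuted. *)
  rewrite -addrA !zJ -rmorphD; congr (_%:C).
  rewrite (sin_half (c 1)) (sin_half (c 2%:R)) -/C1 -/C2 -/C3 -/S1 -/S2 -/S3.
  have := cs (c 0 / 2%:R); have := cs (c 1 / 2%:R); have := cs (c 2%:R / 2%:R).
  rewrite -/C1 -/C2 -/C3 -/S1 -/S2 -/S3.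
  move: C1 C2 C3 S1 S2 S3 {x s0 x0 x1 x2 x3} => C1 C2 C3 S1 S2 S3 e3 e2 e1.
  by ring: e1 e2 e3.
have s2 : x0 * x2^*%R + x2 * x0^*%R + x1 * x3^*%R + x3 * x1^*%R
    = (sin (c 0) * sin (c 2%:R))%:C.
  rewrite -addrA !zJ -rmorphD; congr (_%:C).
  rewrite (sin_half (c 0)) (sin_half (c 2%:R)) -/C1 -/C2 -/C3 -/S1 -/S2 -/S3.
  have := cs (c 0 / 2%:R); have := cs (c 1 / 2%:R); have := cs (c 2%:R / 2%:R).
  rewrite -/C1 -/C2 -/C3 -/S1 -/S2 -/S3.
  move: C1 C2 C3 S1 S2 S3 {x s0 s1 x0 x1 x2 x3} => C1 C2 C3 S1 S2 S3 e3 e2 e1.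
  by ring: e1 e2 e3.
have s3 : x0 * x3^*%R + x3 * x0^*%R + x1 * x2^*%R + x2 * x1^*%R
    = (sin (c 0) * sin (c 1))%:C.
  rewrite -addrA !zJ -rmorphD; congr (_%:C).
  rewrite (sin_half (c 0)) (sin_half (c 1)) -/C1 -/C2 -/C3 -/S1 -/S2 -/S3.
  have := cs (c 0 / 2%:R); have := cs (c 1 / 2%:R); have := cs (c 2%:R / 2%:R).
  rewrite -/C1 -/C2 -/C3 -/S1 -/S2 -/S3.
  move: C1 C2 C3 S1 S2 S3 {x s0 s1 s2 x0 x1 x2 x3} => C1 C2 C3 S1 S2 S3 e3 e2 e1.
  by ring: e1 e2 e3.
rewrite dynmap_pauli_sum //.
rewrite pauli_sandwich_sum s0 s1 s2 s3 mul1r sum_ord3 !addrA mxtrace_conj //.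
by have [-> -> ->] := prod_ord3_neq (fun j => sin (c j)).
Qed.

End GateOnIdentity.

(** * The criterion for unitality *)

Section UnitalityCriterion.
Variable R : realType.
Local Notation C := R[i].

Lemma pauli_comb (z : 'I_3 -> C) : \sum_k z k *: pauli R k =
  mx2 (z 2%:R) (z 0 - 'i%C * z 1) (z 0 + 'i%C * z 1) (- z 2%:R).
Proof.
by rewrite sum_ord3 !pauliE !mx2Z !mx2D; move: ('i%C : C) => im; congr mx2; ring.
Qed.

Lemma pauli_free (z : 'I_3 -> C) : \sum_k z k *: pauli R k = 0 -> forall k, z k = 0.
Proof.
have mx0 : (0 : 'M[C]_2) = mx2 0 0 0 0.
  by rewrite -scalar_mx2 raddf0.
rewrite pauli_comb [X in _ = X]mx0 => /mx2_inj[z2 zm zp _].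
have z0 : z 0 = 0.
  apply: (@mulfI C 2%:R); rewrite ?pnatr_eq0 // mulr0 -[RHS](addr0 0).
  by rewrite -[X in _ = X + _]zm -zp; move: ('i%C : C) => im; ring.
have z1 : z 1 = 0.
  apply: (@mulfI C 'i%C); first by rewrite eq_complex /= oner_eq0 andbF.
  by rewrite mulr0 -zp z0 add0r.
exact: ord3P.
Qed.

Lemma mxtrace_pauli (A : 'M[C]_2) :
  [/\ \tr (pauli R 0 *m A) = A 1 0 + A 0 1,
      \tr (pauli R 1 *m A) = 'i%C * (A 0 1 - A 1 0) &
      \tr (pauli R 2%:R *m A) = A 0 0 - A 1 1].
Proof.
rewrite {1 4 7}[A]mx2_eta !pauliE !mx2M !mxtrace_mx2.
by move: ('i%C : C) => im; split; ring.
Qed.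

(** The three traces are, up to nonzero factors, the difference of the diagonal entries and the sum
    and difference of the off-diagonal ones. *)
Lemma mxtrace_pauli_eq0 (A : 'M[C]_2) :
  (forall k, \tr (pauli R k *m A) = 0) -> A = (\tr A / 2%:R)%:M.
Proof.
have [t0 t1 t2] := mxtrace_pauli A => tA.
transitivity (mx2 (A 0 0) (A 0 1) (A 1 0) (A 1 1)); first exact: mx2_eta.
move: (tA 0) (tA 1) (tA 2%:R); rewrite t0 t1 t2 {t0 t1 t2}.
rewrite scalar_mx2 [\tr A]/mxtrace !big_ord_recl big_ord0.
rewrite (_ : lift ord0 ord0 = 1); last exact: val_inj.
rewrite -[ord0]/(0 : 'I_2).
move: (A 0 0) (A 0 1) (A 1 0) (A 1 1) => a b c d e0.
have i0 : ('i%C : C) != 0 by rewrite eq_complex /= oner_eq0 andbF.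
move=> /eqP; rewrite mulf_eq0 (negPf i0) subr_eq0 => /eqP bc /eqP; rewrite subr_eq0 => /eqP ad.
have c0 : c = 0.
  by apply: (@mulfI C 2%:R); rewrite ?pnatr_eq0 // mulr0 -e0 bc; ring.
by rewrite bc ad c0; congr mx2; field.
Qed.

(** Conjugation by [kS] is invertible and fixes the identity, and the Pauli matrices are linearly
    independent, so each coefficient in [dynmap_gate1] must vanish separately. *)
Lemma unital_gateP (c : 'I_3 -> R) (kS kB kS' kB' rho : 'M[C]_2) :
    special_unitary kS -> special_unitary kB ->
    special_unitary kS' -> special_unitary kB' -> density_matrix rho ->
  unital (dynmap (gate c kS kB kS' kB') rho) <->
  forall k, \prod_(j | j != k) sin (c j) = 0 \/
            \tr (pauli R k *m (kB' *m rho *m kB' ^t*)) = 0.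
Proof.
move=> [uS _] [uB _] [uS' _] [uB' _] [_ _ tr1].
pose z (k : 'I_3) : C := (\prod_(j | j != k) sin (c j))%:C
  * \tr (pauli R k *m (kB' *m rho *m kB' ^t*)).
have zE : dynmap (gate c kS kB kS' kB') rho 1%:M =
    kS *m (1%:M + \sum_k z k *: pauli R k) *m kS ^t*.
  by rewrite dynmap_gate1 // tr1.
have uS1 := unitarymxP uS; have uS2 := mulmx1C uS1.
rewrite /unital zE; split=> [e k|e].
  have z0 : \sum_k z k *: pauli R k = 0.
    apply: (addrI 1%:M); rewrite addr0; move: e; move: (1%:M + _) => X e.
    have -> : X = kS ^t* *m (kS *m X *m kS ^t*) *m kS.
      by rewrite !mulmxA uS2 mul1mx -mulmxA uS2 mulmx1.
    by rewrite e mulmx1.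
  have /eqP := pauli_free z0 k; rewrite mulf_eq0 => /orP[|] /eqP; last by right.
  by move=> /complexI; left.
rewrite big1 ?addr0 ?mulmx1 // => k _; rewrite /z.
by case: (e k) => ->; rewrite ?mul0r ?mulr0 scale0r.
Qed.

End UnitalityCriterion.

(** * Density matrices and local rotations *)

Section StatesAndRotations.
Variable R : realType.
Local Notation C := R[i].

Lemma special_unitary1 n : special_unitary (1%:M : 'M[C]_n).
Proof.
split; last exact: det1.
by apply/unitarymxP; rewrite trmx1 map_mx1 mulmx1.
Qed.

Lemma special_unitaryM n (A B : 'M[C]_n) :
  special_unitary A -> special_unitary B -> special_unitary (A *m B).
Proof.
move=> [uA dA] [uB dB]; split; first exact: (mul_unitarymx uA uB).
by rewrite det_mulmx dA dB mulr1.
Qed.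

Lemma adj_mulmx m n p (A : 'M[C]_(m, n)) (B : 'M[C]_(n, p)) :
  (A *m B) ^t* = B ^t* *m A ^t*.
Proof. by rewrite trmx_mul map_mxM. Qed.

Lemma gram_ge0 n (v : 'cV[C]_n) : 0 <= (v ^t* *m v) 0 0.
Proof.
rewrite mxE; apply: sumr_ge0 => k _; rewrite !mxE mulrC; exact: mul_conjC_ge0.
Qed.

Lemma density_projection n (P : 'M[C]_n) :
  P ^t* = P -> P *m P = P -> \tr P = 1 -> density_matrix P.
Proof.
move=> hP PP tP; split=> // [|v].
  by apply/is_hermitianmxP; rewrite expr0 scale1r.
have -> : v ^t* *m P *m v = (P *m v) ^t* *m (P *m v).
  by rewrite adj_mulmx hP !mulmxA -(mulmxA _ P P) PP.
exact: gram_ge0.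
Qed.

(** Supplies an initial ancilla state whose conjugate by [U] is a prescribed state [A]. *)
Lemma density_conj n (U A : 'M[C]_n) :
  U \is unitarymx -> density_matrix A -> density_matrix (U ^t* *m A *m U).
Proof.
move=> /unitarymxP uU [/is_hermitianmxP hA pA tA]; split=> [|v|].
- move: hA; rewrite expr0 scale1r => hA.
  apply/is_hermitianmxP; rewrite expr0 scale1r !adj_mulmx trmxCK -hA.
  by rewrite mulmxA.
- by have := pA (U *m v); rewrite adj_mulmx !mulmxA.
- by rewrite mxtrace_mulC mulmxA uU mul1mx.
Qed.

(** The pure state in the eigenspace of [pauli R k] for the eigenvalue 1; its Bloch vector is the
    [k]-th unit vector. *)
Definition pauli_state (k : 'I_3) : 'M[C]_2 := 2%:R^-1 *: (1%:M + pauli R k).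

Lemma density_pauli_state k : density_matrix (pauli_state k).
Proof.
have tp : \tr (pauli R k) = 0.
  by move: k; apply: ord3P; rewrite pauliE mxtrace_mx2 ?addr0 ?subrr.
apply: density_projection.
- rewrite /pauli_state linearZ linearD /= map_mxZ map_mxD trmx1 map_mx1 adj_pauli.
  by rewrite fmorphV rmorph_nat.
- rewrite /pauli_state -scalemxAl -scalemxAr scalerA mulmxDl !mulmxDr !mul1mx mulmx1.
  rewrite (pauliM R).1 (addrC (pauli R k)); move: (1%:M + pauli R k) => X.
  have -> : X + X = 2%:R *: X by rewrite scaler_nat mulr2n.
  by rewrite scalerA -mulrA mulVf ?mulr1 ?pnatr_eq0.
- by rewrite linearZ linearD /= tp mxtrace1 addr0 mulVf ?pnatr_eq0.
Qed.

Lemma mxtrace_pauli_state k m : \tr (pauli R k *m pauli_state m) = (k == m)%:R.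
Proof.
have i2 := sqr_i R; rewrite expr2 in i2.
rewrite -scalemxAr linearZ /= mulmxDr mulmx1 linearD /=.
move: k m; apply: ord3P; apply: ord3P; rewrite !pauliE mx2M !mxtrace_mx2 /=;
  by move: ('i%C : C) i2 => im i2; field: i2.
Qed.

Lemma pauli_rotation (k m : 'I_3) : exists V : 'M[C]_2,
  special_unitary V /\ V ^t* *m pauli R k *m V = pauli R m.
Proof.
(* [V] is half of 1 plus ['i] times the sum of the Pauli matrices: the rotation by a third of a turn
   about the axis (1,1,1), which permutes the coordinate axes cyclically. [W] is its adjoint. *)
pose V : 'M[C]_2 := 2%:R^-1 *: mx2 (1 + 'i%C) ('i%C + 1) ('i%C - 1) (1 - 'i%C).
pose W : 'M[C]_2 := 2%:R^-1 *: mx2 (1 - 'i%C) (- 'i%C - 1) (- 'i%C + 1) (1 + 'i%C).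
have ii : ('i%C : C) * 'i%C = -1 by rewrite -expr2 sqr_i.
have VW : V ^t* = W.
  have cD (p q : C) : (p + q)^*%R = p^*%R + q^*%R by exact: rmorphD.
  have cN (p : C) : (- p)^*%R = - p^*%R by exact: rmorphN.
  rewrite /V /W linearZ /= map_mxZ fmorphV rmorph_nat adj_mx2.
  by rewrite !(cD, cN) conjC1 conj_i opprK.
have suV : special_unitary V.
  split.
    apply/unitarymxP; rewrite VW /V /W -scalemxAl -scalemxAr mx2M !mx2Z scalar_mx2.
    by move: ('i%C : C) ii => im ii; congr mx2; field: ii.
  by rewrite detZ det_mx2; move: ('i%C : C) ii => im ii; field: ii.
have step j : V ^t* *m pauli R j *m V = pauli R (j + 1).
  rewrite VW /V /W -!(scalemxAl, scalemxAr).
  have e0 : 0 + 1 = 1 :> 'I_3 by apply: val_inj.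
  have e1 : 1 + 1 = 2%:R :> 'I_3 by apply: val_inj.
  have e2 : 2%:R + 1 = 0 :> 'I_3 by apply: val_inj.
  have quarter (x y : C) : x = 4%:R * y -> 2%:R^-1 * (2%:R^-1 * x) = y.
    by move=> ->; field.
  move: j; apply: ord3P; rewrite ?e0 ?e1 ?e2 !pauliE !mx2M !mx2Z;
    move: ('i%C : C) ii => t tt; congr mx2; apply: quarter; ring: tt.
have rot n : exists U : 'M[C]_2,
    special_unitary U /\ U ^t* *m pauli R k *m U = pauli R (k + n%:R).
  elim: n => [|n [U [sU eU]]].
    exists 1%:M; split; first exact: special_unitary1.
    by rewrite trmx1 map_mx1 mul1mx mulmx1 addr0.
  exists (U *m V); split; first exact: special_unitaryM.
  by rewrite adj_mulmx !mulmxA -2!(mulmxA (V ^t*)) eU step -addrA -mulrSr.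
(* Addition in ['I_3] is modulo 3, so [m - k] steps lead from [k] to [m]. *)
have [U [sU eU]] := rot (val (m - k)); exists U; split => //.
by rewrite eU natr_Zp addrC subrK.
Qed.

Lemma mxtrace_pauli_conj (k : 'I_3) (V A : 'M[C]_2) :
  \tr (pauli R k *m (V *m A *m V ^t*)) = \tr (V ^t* *m pauli R k *m V *m A).
Proof. by rewrite !mulmxA mxtrace_mulC !mulmxA. Qed.

(** Once the axis is turned into the third one, half a turn of the Bloch sphere reverses the third
    coordinate; by continuity it vanishes at some angle in between. *)
Lemma exists_mxtrace_pauli_eq0 (k : 'I_3) (rho : 'M[C]_2) : density_matrix rho ->
  exists W : 'M[C]_2,
    special_unitary W /\ \tr (pauli R k *m (W *m rho *m W ^t*)) = 0.
Proof.
move=> [/is_hermitianmxP hrho _ _].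
have [V [sV eV]] := pauli_rotation k 2%:R.
suff [W [sW tW]] : exists W : 'M[C]_2,
    special_unitary W /\ \tr (pauli R 2%:R *m (W *m rho *m W ^t*)) = 0.
  exists (V *m W); split; first exact: special_unitaryM.
  rewrite -tW mxtrace_pauli_conj [RHS]mxtrace_pauli_conj adj_mulmx -eV.
  by rewrite !mulmxA.
have herm i j : rho i j = (rho j i)^*%R.
  by rewrite {1}hrho expr0 scale1r !mxE.
pose r := complex.Re (rho 0 0 - rho 1 1); pose s := complex.Re (rho 0 1 + rho 1 0).
have rE : rho 0 0 - rho 1 1 = r%:C.
  rewrite /r RRe_real // rpredB // CrealE; apply/eqP; exact/esym/herm.
have sE : rho 0 1 + rho 1 0 = s%:C.
  rewrite /s RRe_real // CrealE rmorphD /= -!herm addrC; exact: eqxx.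
(* This is [cos (2x) * r + sin (2x) * s], the third Bloch coordinate after the real rotation of
   angle [x]; it runs from [r] to [- r]. *)
pose f (x : R) := (cos x * cos x - sin x * sin x) * r + 2%:R * (sin x * cos x) * s.
have f0 : f 0 = r by rewrite /f cos0 sin0; ring.
have f1 : f (pi / 2%:R) = - r by rewrite /f cos_pihalf sin_pihalf; ring.
have [x _ fx] : exists2 x, x \in `[0, pi / 2%:R] & f x = 0.
  apply: IVT; first by rewrite divr_ge0 ?pi_ge0.
    apply/continuous_subspaceT => y.
    have cc := @continuous_cos R y; have cs := @continuous_sin R y.
    apply: cvgD; apply: cvgM; try exact: cvg_cst.
      by apply: cvgB; apply: cvgM.
    by apply: cvgM; [exact: cvg_cst|exact: cvgM].
  rewrite f0 f1 ge_min le_max oppr_ge0 oppr_le0.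
  by have [r0|/ltW r0] := lerP r 0; rewrite ?r0 ?orbT.
pose p := (cos x)%:C : C; pose q := (sin x)%:C : C.
have WE : (mx2 p q (- q) p) ^t* = mx2 p (- q) q p.
  rewrite adj_mx2 /p /q !conj_realC; congr mx2.
  by rewrite -rmorphN conj_realC.
have pq : p * p = 1 - q * q.
  rewrite /p /q -!rmorphM -(rmorph1 (real_complex R)) -rmorphB; congr (_%:C).
  by have := cos2Dsin2 x; rewrite !expr2 => <-; ring.
exists (mx2 p q (- q) p); split.
  split; last by rewrite det_mx2; ring: pq.
  by apply/unitarymxP; rewrite WE mx2M scalar_mx2; congr mx2; ring: pq.
rewrite mxtrace_pauli_conj WE pauliE [rho]mx2_eta !mx2M mxtrace_mx2.
rewrite [LHS](_ : _ = (p * p - q * q) * (rho 0 0 - rho 1 1)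
  + 2%:R * (q * p) * (rho 0 1 + rho 1 0)); last by ring.
rewrite rE sE -(rmorph0 (real_complex R)) -fx /f /p /q.
by rewrite rmorphD !rmorphM rmorphB !rmorphM rmorph_nat.
Qed.

(** A state with zero Bloch vector is half the identity, which conjugation by a unitary leaves
    fixed. *)
Lemma mxtrace_pauli_neq0 (U rho : 'M[C]_2) : U \is unitarymx ->
    density_matrix rho -> rho <> (2%:R^-1)%:M ->
  exists k, \tr (pauli R k *m (U *m rho *m U ^t*)) != 0.
Proof.
move=> uU [_ _ t1] nrho; apply: contrapT => /forallNP h; apply: nrho.
have e : U *m rho *m U ^t* = (2%:R^-1)%:M.
  rewrite [LHS]mxtrace_pauli_eq0 => [|k]; last by apply/eqP/negPn/negP; exact: h.
  by rewrite mxtrace_conj // t1 mul1r.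
have uU' := mulmx1C (unitarymxP uU).
have -> : rho = U ^t* *m (U *m rho *m U ^t*) *m U.
  by rewrite !mulmxA uU' mul1mx -mulmxA uU' mulmx1.
by rewrite e mul_mx_scalar -scalemxAl uU' scalemx1.
Qed.

End StatesAndRotations.

(** * Counting vanishing coordinates *)

Lemma few_nonzero (T : finType) (V : nmodType) (c : T -> V) (k : T) :
    (#|[set j | (c j != 0)%R]%SET| < #|T|.-1)%N -> exists2 j, j != k & c j = 0.
Proof.
(* The complement of [k] has [#|T|.-1] elements, too many to fit into the support of [c]. *)
move=> lt; have /subsetPn[j] : ~~ ([set~ k]%SET \subset [set j | (c j != 0)%R]%SET).
  by apply: contraL lt => /subset_leq_card; rewrite cardsC1 -leqNgt.
by rewrite !inE negbK => jk /eqP cj; exists j.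
Qed.

Lemma one_zero (T : finType) (V : nmodType) (c : T -> V) :
    #|[set j | (c j != 0)%R]%SET| = #|T|.-1 -> (0 < #|T|)%N ->
  exists2 k, c k = 0 & forall j, j != k -> c j != 0.
Proof.
move=> e T0; have /eqP/cards1P[k ek] : #|~: [set j | (c j != 0)%R]%SET| = 1%N.
  by rewrite -[LHS](addKn #|[set j | (c j != 0)%R]%SET|) cardsC e -subn1 subKn.
have ck j : (c j == 0) = (j == k) by move/setP: ek => /(_ j); rewrite !inE negbK.
by exists k => [|j]; [apply/eqP; rewrite ck|rewrite ck].
Qed.

Theorem mainTheorem4 (R : realType) (c : 'I_3 -> R)
    (hc : forall k : 'I_3, 0 <= c k <= pi) :
  [/\
    (* (a) *)
    #|[set k : 'I_3 | (c k != 0)%R]%SET| = 1%N ->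
    forall kS kB kS' kB' rhoB : 'M[R[i]]_2,
      special_unitary kS -> special_unitary kB ->
      special_unitary kS' -> special_unitary kB' ->
      density_matrix rhoB ->
      unital (dynmap (gate c kS kB kS' kB') rhoB),

    (* (b), two non-vanishing coordinates are necessary *)
    forall kS kB kS' kB' rhoB : 'M[R[i]]_2,
      special_unitary kS -> special_unitary kB ->
      special_unitary kS' -> special_unitary kB' ->
      density_matrix rhoB ->
      ~ unital (dynmap (gate c kS kB kS' kB') rhoB) ->
      (2 <= #|[set k : 'I_3 | (c k != 0)%R]%SET|)%N,

    (* (b), two non-vanishing coordinates are not sufficient: unitality still
       depends on rhoB', that is, on rhoB and on kB' *)
    #|[set k : 'I_3 | (c k != 0)%R]%SET| = 2%N ->
    [/\ (* it is a function of rhoB' = kB' rhoB kB'^dagger *)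
        forall kS kB kS' kB' rhoB lS lB lS' lB' tauB : 'M[R[i]]_2,
          special_unitary kS -> special_unitary kB ->
          special_unitary kS' -> special_unitary kB' ->
          density_matrix rhoB ->
          special_unitary lS -> special_unitary lB ->
          special_unitary lS' -> special_unitary lB' ->
          density_matrix tauB ->
          kB' *m rhoB *m kB' ^t* = lB' *m tauB *m lB' ^t* ->
          (unital (dynmap (gate c kS kB kS' kB') rhoB) <->
           unital (dynmap (gate c lS lB lS' lB') tauB)),
        (* for fixed local operations it depends on rhoB *)
        forall kS kB kS' kB' : 'M[R[i]]_2,
          special_unitary kS -> special_unitary kB ->
          special_unitary kS' -> special_unitary kB' ->
          (exists rhoB : 'M[R[i]]_2,
             [/\ density_matrix rhoB, rhoB <> (2%:R^-1)%:M &
                 unital (dynmap (gate c kS kB kS' kB') rhoB)]) /\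
          ((forall k : 'I_3, c k < pi) ->
           exists rhoB : 'M[R[i]]_2,
             density_matrix rhoB /\
             ~ unital (dynmap (gate c kS kB kS' kB') rhoB))
      & (* for a fixed ancilla state it depends on kB' *)
        forall kS kB kS' rhoB : 'M[R[i]]_2,
          special_unitary kS -> special_unitary kB -> special_unitary kS' ->
          density_matrix rhoB -> rhoB <> (2%:R^-1)%:M ->
          (exists kB' : 'M[R[i]]_2,
             special_unitary kB' /\
             unital (dynmap (gate c kS kB kS' kB') rhoB)) /\
          ((forall k : 'I_3, c k < pi) ->
           exists kB' : 'M[R[i]]_2,
             special_unitary kB' /\
             ~ unital (dynmap (gate c kS kB kS' kB') rhoB))]
  &
    (* (c); c_k = pi is excluded, since there the k-th factor of the
       exponential is i sigma_k (x) sigma_k, a local gate *)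
    (forall k : 'I_3, c k != 0) -> (forall k : 'I_3, c k < pi) ->
    forall kS kB kS' kB' rhoB : 'M[R[i]]_2,
      special_unitary kS -> special_unitary kB ->
      special_unitary kS' -> special_unitary kB' ->
      density_matrix rhoB -> rhoB <> (2%:R^-1)%:M ->
      ~ unital (dynmap (gate c kS kB kS' kB') rhoB)].
Proof.
have zero_prod k j : j != k -> c j = 0 -> \prod_(i | i != k) sin (c i) = 0.
  by move=> jk cj; rewrite (bigD1 j) //= cj sin0 mul0r.
(* The sine is positive strictly between 0 and [pi]; the bound below [pi] excludes its other
   zero. *)
have prod_neq0 k : (forall j, c j < pi) -> (forall j, j != k -> c j != 0) ->
    \prod_(j | j != k) sin (c j) != 0.
  move=> cpi c0; apply/prodf_neq0 => j jk; rewrite gt_eqF // sin_gt0_pi // cpi andbT.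
  by rewrite lt_def c0 //; have /andP[] := hc j.
(* With at most one nonzero coordinate, every product over [j != k] contains a vanishing sine. This
   gives both (a) and the necessity in (b). *)
have few kS kB kS' kB' rho : (#|[set k : 'I_3 | (c k != 0)%R]%SET| < 2)%N ->
    special_unitary kS -> special_unitary kB -> special_unitary kS' ->
    special_unitary kB' -> density_matrix rho ->
    unital (dynmap (gate c kS kB kS' kB') rho).
  move=> lt2 sS sB sS' sB' dr; apply/unital_gateP => // k; left.
  have [|j jk cj] := @few_nonzero _ _ c k; first by rewrite card_ord.
  exact: zero_prod cj.
split.
- by move=> e *; apply: few; rewrite ?e.
- move=> kS kB kS' kB' rho sS sB sS' sB' dr nu; rewrite leqNgt; apply/negP => lt2.
  exact/nu/few.
- move=> e2.
  have e3 : #|[set k : 'I_3 | (c k != 0)%R]%SET| = #|'I_3|.-1 by rewrite e2 card_ord.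
  have [|k ck cj] := one_zero e3; first by rewrite card_ord.
  (* Here [k] is the only index with [c k = 0]. The products for the other indices contain
     [sin (c k)], so only the [k]-th Bloch coordinate can obstruct unitality. *)
  have unitalE kS kB kS' kB' rho : special_unitary kS -> special_unitary kB ->
      special_unitary kS' -> special_unitary kB' -> density_matrix rho ->
      \tr (pauli R k *m (kB' *m rho *m kB' ^t*)) = 0 ->
      unital (dynmap (gate c kS kB kS' kB') rho).
    move=> sS sB sS' sB' dr t0; apply/unital_gateP => // m.
    have [->|mk] := eqVneq m k; first by right.
    by left; apply: zero_prod ck; rewrite eq_sym.
  have nunitalE kS kB kS' kB' rho : special_unitary kS -> special_unitary kB ->
      special_unitary kS' -> special_unitary kB' -> density_matrix rho ->
      (forall j, c j < pi) -> \tr (pauli R k *m (kB' *m rho *m kB' ^t*)) != 0 ->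
      ~ unital (dynmap (gate c kS kB kS' kB') rho).
    move=> sS sB sS' sB' dr cpi t0 /(unital_gateP c sS sB sS' sB' dr)/(_ k)[/eqP|/eqP].
      by rewrite (negPf (prod_neq0 _ _ _)).
    by rewrite (negPf t0).
  split.
  + move=> kS kB kS' kB' rho lS lB lS' lB' tau sS sB sS' sB' dr rS rB rS' rB' dt e.
    by split=> /unital_gateP u; apply/unital_gateP => // m; have := u _ _ _ _ _ m;
      rewrite e; apply.
  + move=> kS kB kS' kB' sS sB sS' sB'; have [uB' _] := sB'.
    have uB1 := unitarymxP uB'.
    have conjK m : kB' *m (kB' ^t* *m pauli_state R m *m kB') *m kB' ^t* = pauli_state R m.
      by rewrite !mulmxA uB1 mul1mx -mulmxA uB1 mulmx1.
    have dm m := density_conj uB' (density_pauli_state R m).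
    split.
      (* A state polarized along another axis, pulled back through [kB']: its [k]-th coordinate is
         0, while coordinate [k + 1] is 1 and separates it from the maximally mixed state. *)
      exists (kB' ^t* *m pauli_state R (k + 1) *m kB'); split => //.
        move=> e; have := mxtrace_pauli_state R (k + 1) (k + 1).
        rewrite -(conjK (k + 1)) e mul_mx_scalar -scalemxAl uB1 -scalemxAr mulmx1.
        rewrite linearZ /= (_ : \tr _ = 0) ?mulr0 ?eqxx => [/eqP|].
          by rewrite eq_sym oner_eq0.
        by move: (k + 1); apply: ord3P; rewrite pauliE mxtrace_mx2 ?addr0 ?subrr.
      apply: unitalE => //; rewrite conjK mxtrace_pauli_state.
      by case: eqP => // /eqP; rewrite -subr_eq0 opprD addrA subrr sub0r oppr_eq0.
    move=> cpi; exists (kB' ^t* *m pauli_state R k *m kB'); split => //.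
    by apply: nunitalE => //; rewrite conjK mxtrace_pauli_state eqxx oner_eq0.
  + move=> kS kB kS' rho sS sB sS' dr nrho; split.
      have [W [sW tW]] := exists_mxtrace_pauli_eq0 k dr.
      by exists W; split => //; apply: unitalE.
    move=> cpi.
    (* A state other than half the identity has some nonzero Bloch coordinate [m], which [V] turns
       into the [k]-th one. *)
    have [m] := mxtrace_pauli_neq0 (special_unitary1 R 2).1 dr nrho.
    rewrite trmx1 map_mx1 mul1mx mulmx1 => tm.
    have [V [sV eV]] := pauli_rotation R k m.
    by exists V; split => //; apply: nunitalE => //; rewrite mxtrace_pauli_conj eV.
- move=> c0 cpi kS kB kS' kB' rho sS sB sS' sB' dr nrho.
  move=> /(unital_gateP c sS sB sS' sB' dr) u.
  have [k tk] := mxtrace_pauli_neq0 sB'.1 dr nrho.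
  case: (u k) => /eqP; last by rewrite (negPf tk).
  by rewrite (negPf (prod_neq0 k cpi _)).
Qed.
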